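(* Fix $p\in\mathbb{H}$. Then $|(q-p)^{*n}|\le\sigma(q,p)^n$ for all $n\in\mathbb{N}$ and all $q\in\mathbb{H}$, and $|(q-p)^{-*m}|\le\tau(q,p)^{-m}$ for all $m\in\mathbb{N}$ and all $q\in\mathbb{H}$ with $\tau(q,p)>0$. Moreover, $$\lim_{n\to+\infty}|(q-p)^{*n}|^{1/n}=\sigma(q,p)\quad\text{for all }q\in\mathbb{H},$$ $$\lim_{m\to+\infty}|(q-p)^{-*m}|^{1/m}=\frac1{\tau(q,p)}\quad\text{for all }q\in\mathbb{H}\text{ with }\tau(q,p)>0.$$
   Context: $\mathbb{H}$ denotes the quaternions, $\mathbb{S}=\{q\in\mathbb{H}:q^2=-1\}$, $x+y\mathbb{S}=\{x+Jy:J\in\mathbb{S}\}$. A function $f$ on an open set $\Omega\subseteq\mathbb{H}$ is regular if for all $I\in\mathbb{S}$ its restriction $f_I$ to $\Omega\cap(\mathbb{R}+I\mathbb{R})$ has continuous partial derivatives and $\frac12\left(\frac{\partial}{\partial x}+I\frac{\partial}{\partial y}\right)f_I(x+Iy)\equiv0$. For $p\in\mathbb{R}+I\mathbb{R}$ and $n\in\mathbb{N}$, $(q-p)^{*n}$ is the $n$-th power of $q\mapsto q-p$ for the product $*$ of polynomials $\left(\sum q^ka_k\right)*\left(\sum q^kb_k\right)=\sum_k q^k\sum_{l=0}^k a_lb_{k-l}$; it is the unique regular function on $\mathbb{H}$ whose restriction to $\mathbb{R}+I\mathbb{R}$ is $z\mapsto(z-p)^n$. For $m\in\mathbb{N}$,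 $(q-p)^{-*m}$ is the regular reciprocal of $(q-p)^{*m}$: if $p=x+Iy$ then $$(q-p)^{-*m}=\left[(q-x)^2+y^2\right]^{-m}(q-\bar p)^{*m}\qquad\text{on }\mathbb{H}\setminus(x+y\mathbb{S}),$$ and it is the unique regular function there whose restriction to $\mathbb{R}+I\mathbb{R}$ is $z\mapsto(z-p)^{-m}$. If $p\notin\mathbb{R}$, at the point $q=\bar p$ the symbol $(q-p)^{-*m}$ is given the value $(\bar p-p)^{-m}$. $\sigma(q,p)=\tau(q,p)=|q-p|$ if $p,q$ lie on the same complex line $\mathbb{R}+I\mathbb{R}$ for some $I\in\mathbb{S}$; otherwise $$\sigma(q,p)=\sqrt{(\mathrm{Re}\,q-\mathrm{Re}\,p)^2+(|\mathrm{Im}\,q|+|\mathrm{Im}\,p|)^2},\qquad\tau(q,p)=\sqrt{(\mathrm{Re}\,q-\mathrm{Re}\,p)^2+(|\mathrm{Im}\,q|-|\mathrm{Im}\,p|)^2}.$$ The points with $\tau(q,p)>0$ are exactly the points of $\mathbb{H}\setminus(x+y\mathbb{S})$ together with $\bar p$ when $p\notin\mathbb{R}$. *)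

(* Defs.v *)
From HB Require Import structures.
From mathcomp Require Import all_boot all_order all_algebra.
From mathcomp Require Import ring lra.
From mathcomp Require Import all_classical all_reals all_analysis.
Set Implicit Arguments.
Unset Strict Implicit.
Unset Printing Implicit Defensive.
Import Order.TTheory GRing.Theory Num.Theory.
Import numFieldNormedType.Exports.
Local Open Scope ring_scope.

(* Quat a b c d is a + b i + c j + d k. *)
Record quat (R : realType) := Quat { qa : R; qb : R; qc : R; qd : R }.

Definition tuple_of_quat (R : realType) (q : quat R) : R * R * R * R :=
  (qa q, qb q, qc q, qd q).
Definition quat_of_tuple (R : realType) (t : R * R * R * R) : quat R :=
  let: (a, b, c, d) := t in Quat a b c d.
Lemma tuple_of_quatK (R : realType) :
  cancel (@tuple_of_quat R) (@quat_of_tuple R).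
Proof. by case. Qed.

HB.instance Definition _ (R : realType) :=
  Choice.copy (quat R) (can_type (@tuple_of_quatK R)).

Definition qreal (R : realType) (a : R) : quat R := Quat a 0 0 0.
Definition qadd (R : realType) (p q : quat R) : quat R :=
  Quat (qa p + qa q) (qb p + qb q) (qc p + qc q) (qd p + qd q).
Definition qopp (R : realType) (q : quat R) : quat R :=
  Quat (- qa q) (- qb q) (- qc q) (- qd q).
Definition qmul (R : realType) (p q : quat R) : quat R :=
  let: Quat a b c d := p in
  let: Quat a' b' c' d' := q in
  Quat (a * a' - b * b' - c * c' - d * d')
       (a * b' + b * a' + c * d' - d * c')
       (a * c' - b * d' + c * a' + d * b')
       (a * d' + b * c' - c * b' + d * a').

Lemma qaddA (R : realType) : associative (@qadd R).
Proof. by case=> a b c d [????] [????]; congr Quat => /=; ring. Qed.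
Lemma qaddC (R : realType) : commutative (@qadd R).
Proof. by case=> a b c d [????]; congr Quat => /=; ring. Qed.
Lemma qadd0q (R : realType) : left_id (qreal 0) (@qadd R).
Proof. by case=> a b c d; congr Quat => /=; ring. Qed.
Lemma qaddNq (R : realType) : left_inverse (qreal 0) (@qopp R) (@qadd R).
Proof. by case=> a b c d; congr Quat => /=; ring. Qed.

HB.instance Definition _ (R : realType) :=
  GRing.isZmodule.Build (quat R) (@qaddA R) (@qaddC R) (@qadd0q R) (@qaddNq R).

Lemma qmulA (R : realType) : associative (@qmul R).
Proof. by case=> a b c d [????] [????]; congr Quat => /=; ring. Qed.
Lemma qmul1q (R : realType) : left_id (qreal 1) (@qmul R).
Proof. by case=> a b c d; congr Quat => /=; ring. Qed.
Lemma qmulq1 (R : realType) : right_id (qreal 1) (@qmul R).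
Proof. by case=> a b c d; congr Quat => /=; ring. Qed.
Lemma qmulDl (R : realType) : left_distributive (@qmul R) (@qadd R).
Proof. by case=> a b c d [????] [????]; congr Quat => /=; ring. Qed.
Lemma qmulDr (R : realType) : right_distributive (@qmul R) (@qadd R).
Proof. by case=> a b c d [????] [????]; congr Quat => /=; ring. Qed.
Lemma qreal1_neq0 (R : realType) : qreal 1 != 0 :> quat R.
Proof. by apply/eqP => -[] /eqP; rewrite oner_eq0. Qed.

HB.instance Definition _ (R : realType) :=
  GRing.Zmodule_isNzRing.Build (quat R)
    (@qmulA R) (@qmul1q R) (@qmulq1 R) (@qmulDl R) (@qmulDr R) (@qreal1_neq0 R).

Definition qconj (R : realType) (q : quat R) : quat R :=
  Quat (qa q) (- qb q) (- qc q) (- qd q).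
Definition qre (R : realType) (q : quat R) : R := qa q.
Definition qim (R : realType) (q : quat R) : quat R :=
  Quat 0 (qb q) (qc q) (qd q).
Definition qnorm (R : realType) (q : quat R) : R :=
  Num.sqrt (qa q ^+ 2 + qb q ^+ 2 + qc q ^+ 2 + qd q ^+ 2).

Definition qinv (R : realType) (q : quat R) : quat R :=
  qreal (qnorm q ^+ 2)^-1 * qconj q.

Lemma qnorm2 (R : realType) (q : quat R) :
  qnorm q ^+ 2 = qa q ^+ 2 + qb q ^+ 2 + qc q ^+ 2 + qd q ^+ 2.
Proof. by rewrite sqr_sqrtr // !addr_ge0 // sqr_ge0. Qed.

Lemma qnorm2_neq0 (R : realType) (q : quat R) :
  q != 0 -> qnorm q ^+ 2 != 0.
Proof.
rewrite qnorm2; case: q => a b c d /=; apply: contraNneq => /eqP.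
rewrite !paddr_eq0 ?addr_ge0 ?sqr_ge0 // !sqrf_eq0.
by move=> /andP[/andP[/andP[/eqP-> /eqP->] /eqP->] /eqP->].
Qed.

Lemma qmulVq (R : realType) :
  {in [pred q : quat R | q != 0], left_inverse 1 (@qinv R) *%R}.
Proof.
move=> q /qnorm2_neq0; rewrite /qinv qnorm2.
by case: q => a b c d /= n0; congr Quat => /=; field.
Qed.

Lemma qmulqV (R : realType) :
  {in [pred q : quat R | q != 0], right_inverse 1 (@qinv R) *%R}.
Proof.
move=> q /qnorm2_neq0; rewrite /qinv qnorm2.
by case: q => a b c d /= n0; congr Quat => /=; field.
Qed.

Lemma qunitP (R : realType) (p q : quat R) :
  q * p = 1 /\ p * q = 1 -> [pred q : quat R | q != 0] p.
Proof.
by move=> [+ _]; apply: contra_eqN => /eqP->; rewrite mulr0 eq_sym oner_eq0.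
Qed.

Lemma qinv_out (R : realType) :
  {in [predC [pred q : quat R | q != 0]], @qinv R =1 id}.
Proof. by move=> q; rewrite !inE negbK => /eqP->; congr Quat => /=; ring. Qed.

HB.instance Definition _ (R : realType) :=
  GRing.NzRing_hasMulInverse.Build (quat R)
    (@qmulVq R) (@qmulqV R) (@qunitP R) (@qinv_out R).

(* Value at q of sum_k q^k a_k.  The powers of the variable stand to the left
   of the coefficients, unlike in the library's p.[x].  The product of
   {poly (quat R)} is the *-product, as the indeterminate is central. *)
Definition qeval (R : realType) (P : {poly quat R}) (q : quat R) : quat R :=
  \sum_(k < size P) q ^+ k * P`_k.

Definition star_pow (R : realType) (p : quat R) (n : nat) (q : quat R) :
  quat R := qeval (('X - p%:P) ^+ n) q.

(* (q - p)^{-*m}: here x = Re p and y^2 = |Im p|^2 whenever p = x + I y.  The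
   formula is meant for q outside x + y S.  At q = conj p with p not real the
   value is (conj p - p)^-m; the values at the remaining points of x + y S
   (including p itself) are junk. *)
Definition star_npow (R : realType) (p : quat R) (m : nat) (q : quat R) :
  quat R :=
  if q == qconj p then (qconj p - p) ^- m
  else ((q - qreal (qre p)) ^+ 2 + qreal (qnorm (qim p) ^+ 2)) ^- m
       * star_pow (qconj p) m q.

Definition qline (R : realType) (I q : quat R) : Prop :=
  exists x y : R, q = qreal x + I * qreal y.

Definition same_line (R : realType) (p q : quat R) : Prop :=
  exists I : quat R, [/\ I ^+ 2 = -1, qline I p & qline I q].

Definition sigma (R : realType) (q p : quat R) : R :=
  if `[< same_line q p >] then qnorm (q - p)
  else Num.sqrt ((qre q - qre p) ^+ 2 + (qnorm (qim q) + qnorm (qim p)) ^+ 2).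

Definition tau (R : realType) (q p : quat R) : R :=
  if `[< same_line q p >] then qnorm (q - p)
  else Num.sqrt ((qre q - qre p) ^+ 2 + (qnorm (qim q) - qnorm (qim p)) ^+ 2).

(* Main.v *)
(** The value f_n of (q - p)^{*n} at q satisfies f_0 = 1 and
    f_(n+1) = q f_n - f_n p, so it is an orbit of the operator
    T f = q f - f p on the Euclidean space of quaternions.  This operator is
    normal: T^* T = K - 2 S, where K = (Re q - Re p)^2 + |Im q|^2 + |Im p|^2
    and the symmetric operator S, with <f, S f> = <(Im q) f, f (Im p)>,
    commutes with T and satisfies S^2 = m^2 for m = |Im q| |Im p|.  Hence
      2 m |f_n|^2 = (m + c) (K - 2 m)^n + (m - c) (K + 2 m)^n
    with c = <Im q, Im p>.  If p and q do not lie on a common complex line,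
    then K + 2 m = sigma^2, K - 2 m = tau^2 and |c| < m, so that |f_n| is
    comparable to sigma^n.  For the negative powers one replaces p by its
    conjugate, which changes the sign of c, and divides by
    |(q - Re p)^2 + |Im p|^2|^n = (sigma tau)^n.  On a common complex line
    everything commutes. *)

Require Import Defs.
From mathcomp Require Import all_boot all_order all_algebra.
From mathcomp Require Import ring lra.
From mathcomp Require Import all_classical all_reals all_analysis.
Import Order.TTheory GRing.Theory Num.Theory.
Import numFieldNormedType.Exports.
Local Open Scope classical_set_scope.
Local Open Scope ring_scope.

Section StarPowers.
Variable R : realType.
Implicit Types p q : quat R.

(** * Coordinates, the multiplicative norm and commutation *)

Lemma quat_mulE p q : p * q =
  Quat (qa p * qa q - qb p * qb q - qc p * qc q - qd p * qd q)
       (qa p * qb q + qb p * qa q + qc p * qd q - qd p * qc q)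
       (qa p * qc q - qb p * qd q + qc p * qa q + qd p * qb q)
       (qa p * qd q + qb p * qc q - qc p * qb q + qd p * qa q).
Proof. by case: p q => a b c d [? ? ? ?]. Qed.

Lemma quat_addE p q :
  p + q = Quat (qa p + qa q) (qb p + qb q) (qc p + qc q) (qd p + qd q).
Proof. by []. Qed.

Lemma quat_oppE q : - q = Quat (- qa q) (- qb q) (- qc q) (- qd q).
Proof. by []. Qed.

Definition quatE := (quat_mulE, quat_addE, quat_oppE).

Lemma quat_unitE q : (q \is a GRing.unit) = (q != 0).
Proof. by []. Qed.

Lemma qnorm_ge0 q : 0 <= qnorm q.
Proof. exact: sqrtr_ge0. Qed.

Lemma qnormM p q : qnorm (p * q) = qnorm p * qnorm q.
Proof.
rewrite /qnorm -sqrtrM ?addr_ge0 ?sqr_ge0 //; congr Num.sqrt.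
by rewrite quatE /=; ring.
Qed.

Lemma qnorm1 : qnorm (1 : quat R) = 1.
Proof. by rewrite /qnorm /= expr1n expr0n /= !addr0 sqrtr1. Qed.

Lemma qnorm0 : qnorm (0 : quat R) = 0.
Proof. by rewrite /qnorm /= expr0n /= !addr0 sqrtr0. Qed.

Lemma qnormX q n : qnorm (q ^+ n) = qnorm q ^+ n.
Proof.
by elim: n => [|n IHn]; rewrite ?qnorm1 // !exprS qnormM IHn.
Qed.

Lemma qnorm_eq0 q : (qnorm q == 0) = (q == 0).
Proof.
apply/eqP/eqP => [q0|->]; last exact: qnorm0.
by apply/eqP; apply: contra_eqT q0 => /qnorm2_neq0; rewrite sqrf_eq0.
Qed.

Lemma qnormV q : qnorm q^-1 = (qnorm q)^-1.
Proof.
have [->|q0] := eqVneq q 0; first by rewrite invr0 qnorm0 invr0.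
have n0 : qnorm q != 0 by rewrite qnorm_eq0.
by apply: (mulfI n0); rewrite divff // -qnormM divrr ?qnorm1.
Qed.

Lemma same_line_comm p q : same_line q p -> q * p = p * q.
Proof.
case=> I [_ [x [y ->]] [u [v ->]]]; rewrite !quatE /=; congr Quat; ring.
Qed.

(** Real quaternions are central, so in this form whatever commutes with [q] is seen to commute with
    its conjugate. *)
Lemma qconjE q : qconj q = qreal (2 * qre q) - q.
Proof. by rewrite !quatE /qconj /qreal /qre /=; congr Quat; ring. Qed.

Lemma qreal_comm q (a : R) : GRing.comm q (qreal a).
Proof. by rewrite /GRing.comm !quatE /=; congr Quat; ring. Qed.

Lemma comm_qconj p q : GRing.comm q p -> GRing.comm q (qconj p).
Proof. by move=> qp; rewrite qconjE; apply: commrB => //; exact: qreal_comm. Qed.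

(** * Inner product, parallel imaginary parts and complex lines *)

Definition qinner p q : R :=
  qa p * qa q + qb p * qb q + qc p * qc q + qd p * qd q.

Lemma qnorm_inner q : qnorm q ^+ 2 = qinner q q.
Proof. by rewrite qnorm2 /qinner !expr2. Qed.

(** Equality case of Cauchy-Schwarz: [k] is the coefficient of the orthogonal projection of [qim q]
    on [qim p], and the residual has norm zero. *)
Lemma qinner_parallel p q : qim p != 0 ->
  qinner (qim q) (qim p) ^+ 2 = qinner (qim q) (qim q) * qinner (qim p) (qim p) ->
  exists k : R, qim q = qreal k * qim p.
Proof.
move=> p0 par; have := qnorm2_neq0 p0; rewrite qnorm_inner => n0.
exists (qinner (qim q) (qim p) / qinner (qim p) (qim p)).
set k := (_ / _); apply/eqP; rewrite -subr_eq0 -qnorm_eq0 -sqrf_eq0 qnorm_inner.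
have -> : qinner (qim q - qreal k * qim p) (qim q - qreal k * qim p) =
  qinner (qim q) (qim q) - 2 * k * qinner (qim q) (qim p)
  + k ^+ 2 * qinner (qim p) (qim p).
  by rewrite /qinner !quatE /=; ring.
apply/eqP; rewrite /k; apply: (mulIf n0); rewrite mul0r.
(* Times [qinner (qim p) (qim p)], the squared norm of the residual is the Gram determinant. *)
transitivity (qinner (qim q) (qim q) * qinner (qim p) (qim p)
  - qinner (qim q) (qim p) ^+ 2); last by rewrite par subrr.
by field.
Qed.

Lemma qline_normalized_qim p q (k : R) : qim p != 0 -> qim q = qreal k * qim p ->
  qline (qreal (qnorm (qim p))^-1 * qim p) q.
Proof.
rewrite -qnorm_eq0 => n0 qE; exists (qre q), (k * qnorm (qim p)).
have {1}-> : q = qreal (qre q) + qim q.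
  by case: q {qE} => a b c d; rewrite !quatE /=; congr Quat; ring.
by rewrite qE !quatE /=; congr Quat; field.
Qed.

Lemma normalized_qim_sqr p : qim p != 0 ->
  (qreal (qnorm (qim p))^-1 * qim p) ^+ 2 = -1 :> quat R.
Proof.
move=> p0; have n0 := p0; rewrite -qnorm_eq0 in n0.
have nE := qnorm_inner (qim p).
have -> : (qreal (qnorm (qim p))^-1 * qim p) ^+ 2 =
    qreal (- (qinner (qim p) (qim p) / qnorm (qim p) ^+ 2)) :> quat R.
  by rewrite expr2 !quatE /qinner /qreal /=; congr Quat; field.
by rewrite -nE divff ?sqrf_eq0 // quatE /qreal /= oppr0.
Qed.

Lemma qline_real (I q : quat R) : qim q = 0 -> qline I q.
Proof.
move=> q0; exists (qre q), 0.
have {1}-> : q = qreal (qre q) + qim q.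
  by case: q {q0} => a b c d; rewrite !quatE /=; congr Quat; ring.
by rewrite q0; congr (_ + _); rewrite mulr0.
Qed.

Lemma qim_self p : qim p = qreal 1 * qim p.
Proof. by rewrite !quatE /= /qim; congr Quat; ring. Qed.

Lemma parallel_same_line p q :
  qinner (qim q) (qim p) ^+ 2 = qinner (qim q) (qim q) * qinner (qim p) (qim p) ->
  same_line q p.
Proof.
move=> par; have [p0|p0] := eqVneq (qim p) 0.
  have [q0|q0] := eqVneq (qim q) 0.
    (* Both points are real and lie on every line, so any imaginary unit serves; here it is [i]. *)
    exists (Quat 0 1 0 0); split; [|exact: qline_real..].
    by rewrite expr2 !quatE /=; congr Quat; ring.
  exists (qreal (qnorm (qim q))^-1 * qim q); split.
  - exact: normalized_qim_sqr.
  - exact: (qline_normalized_qim _ _ _ q0 (qim_self q)).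
  - exact: qline_real.
have [k qE] := qinner_parallel _ _ p0 par.
exists (qreal (qnorm (qim p))^-1 * qim p); split.
- exact: normalized_qim_sqr.
- exact: (qline_normalized_qim _ _ _ p0 qE).
- exact: (qline_normalized_qim _ _ _ p0 (qim_self p)).
Qed.

Lemma same_line_qconj p : same_line (qconj p) p.
Proof. by apply: parallel_same_line; rewrite /qinner /=; ring. Qed.

(** Lagrange's identity: the difference is the sum of the squares of the 2 by 2 minors. *)
Lemma qinner_cauchy p q : qinner q p ^+ 2 <= qinner q q * qinner p p.
Proof.
rewrite -subr_ge0.
have -> : qinner q q * qinner p p - qinner q p ^+ 2 =
    (qa q * qb p - qb q * qa p) ^+ 2 + (qa q * qc p - qc q * qa p) ^+ 2
  + (qa q * qd p - qd q * qa p) ^+ 2 + (qb q * qc p - qc q * qb p) ^+ 2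
  + (qb q * qd p - qd q * qb p) ^+ 2 + (qc q * qd p - qd q * qc p) ^+ 2.
  by rewrite /qinner; ring.
by rewrite !addr_ge0 ?sqr_ge0.
Qed.

(** Equality in Cauchy-Schwarz would put [p] and [q] on a common line. The strictness makes both
    weights [m + c] and [m - c] positive later. *)
Lemma not_same_line_inner p q : ~ same_line q p ->
  `|qinner (qim q) (qim p)| < qnorm (qim q) * qnorm (qim p).
Proof.
move=> nsl; rewrite ltNge; apply/negP => le; apply: nsl.
apply/parallel_same_line/le_anti; rewrite qinner_cauchy /=.
rewrite -!qnorm_inner -exprMn -[leRHS]real_normK ?num_real //.
by rewrite ler_sqr ?nnegrE ?mulr_ge0 ?qnorm_ge0.
Qed.

(** * Evaluation of polynomials and the recursion for star powers *)

Lemma qeval_widen (P : {poly quat R}) q n : (size P <= n)%N ->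
  qeval P q = \sum_(k < n) q ^+ k * P`_k.
Proof.
move=> le; rewrite /qeval (big_ord_widen n (fun k => q ^+ k * P`_k)) //.
rewrite big_mkcond /=; apply: eq_bigr => k _; case: ifPn => //.
by rewrite -leqNgt => ?; rewrite nth_default ?mulr0.
Qed.

Lemma qevalB (P Q : {poly quat R}) q : qeval (P - Q) q = qeval P q - qeval Q q.
Proof.
pose n := maxn (size P) (size Q).
rewrite !(@qeval_widen _ _ n) ?leq_maxl ?leq_maxr //; last first.
  by rewrite (leq_trans (size_polyD _ _)) // size_polyN.
by rewrite -sumrB; apply: eq_bigr => k _; rewrite coefB mulrBr.
Qed.

Lemma qevalMX (P : {poly quat R}) q : qeval (P * 'X) q = q * qeval P q.
Proof.
rewrite (@qeval_widen _ _ (size P).+1); last first.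
  by rewrite (leq_trans (size_polyMleq _ _)) // size_polyX addn2.
rewrite big_ord_recl coefMX eqxx mulr0 add0r /qeval mulr_sumr.
by apply: eq_bigr => k _; rewrite coefMX /= exprS mulrA.
Qed.

Lemma qevalMC (P : {poly quat R}) q p : qeval (P * p%:P) q = qeval P q * p.
Proof.
rewrite (@qeval_widen _ _ (size P)); last first.
  rewrite (leq_trans (size_polyMleq _ _)) //.
  have := size_polyC_leq1 p; case: (size p%:P) => [|[|//]] _; rewrite ?addn0 ?addn1 //.
  exact: leq_pred.
by rewrite /qeval mulr_suml; apply: eq_bigr => k _; rewrite coefMC mulrA.
Qed.

Lemma star_pow0 p q : star_pow p 0 q = 1.
Proof. by rewrite /star_pow expr0 /qeval size_poly1 big_ord1 coef1 mulr1. Qed.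

(** Evaluation is not multiplicative, but a right factor ['X] becomes left multiplication by [q],
    while a constant right factor stays on the right. Hence the last factor is split off. *)
Lemma star_powS p n q :
  star_pow p n.+1 q = q * star_pow p n q - star_pow p n q * p.
Proof. by rewrite /star_pow exprSr mulrBr qevalB qevalMX qevalMC. Qed.

Lemma star_pow_comm p q n : GRing.comm q p -> star_pow p n q = (q - p) ^+ n.
Proof.
move=> qp; elim: n => [|n IHn]; first exact: star_pow0.
have cp : GRing.comm p ((q - p) ^+ n).
  by apply/commrX/commrB; [exact/commr_sym|exact: commr_refl].
by rewrite star_powS IHn -cp -mulrBl -exprS.
Qed.

(** * Squared norms of star powers *)

Definition far2 q p : R :=
  (qre q - qre p) ^+ 2 + (qnorm (qim q) + qnorm (qim p)) ^+ 2.
(** [near2] and [far2] are the least and the greatest squared distance from [p] to the sphere of the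
    points with the real part and the imaginary modulus of [q]. *)
Definition near2 q p : R :=
  (qre q - qre p) ^+ 2 + (qnorm (qim q) - qnorm (qim p)) ^+ 2.

Lemma star_pow_norm2 p q n :
  let m := qnorm (qim q) * qnorm (qim p) in
  let c := qinner (qim q) (qim p) in
  2 * m * qnorm (star_pow p n q) ^+ 2 =
  (m + c) * near2 q p ^+ n + (m - c) * far2 q p ^+ n.
Proof.
move=> m c; pose f n := star_pow p n q.
pose N n := qinner (f n) (f n); pose S n := qinner (qim q * f n) (f n * qim p).
pose K := (qre q - qre p) ^+ 2 + qnorm (qim q) ^+ 2 + qnorm (qim p) ^+ 2.
have m2 : m ^+ 2 = qinner (qim q) (qim q) * qinner (qim p) (qim p).
  by rewrite exprMn !qnorm_inner.
(* This recursion and the next are polynomial identities in an arbitrary quaternion [g] put for the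
   star power. *)
have NS k : N k.+1 = K * N k - 2 * S k.
  rewrite /N /S /K !qnorm_inner /f star_powS; move: (star_pow p k q) => g.
  by rewrite /qinner !quatE /qre /=; ring.
have SS k : S k.+1 = K * S k - 2 * m ^+ 2 * N k.
  rewrite /N /S /K m2 !qnorm_inner /f star_powS; move: (star_pow p k q) => g.
  by rewrite /qinner !quatE /qre /=; ring.
have near2E : near2 q p = K - 2 * m by rewrite /near2 /K /m; ring.
have far2E : far2 q p = K + 2 * m by rewrite /far2 /K /m; ring.
have N0 : N 0 = 1 by rewrite /N /f star_pow0 /qinner /=; ring.
have S0 : S 0 = c by rewrite /S /f star_pow0 mulr1 mul1r.
(* The combinations [m * N k + S k] and [m * N k - S k] diagonalise the recursion, with eigenvalues
   [K - 2 * m] and [K + 2 * m]. *)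
have plus k : m * N k + S k = (m + c) * near2 q p ^+ k.
  elim: k => [|k IHk]; first by rewrite N0 S0; ring.
  by rewrite exprS mulrCA -IHk NS SS near2E; ring.
have minus k : m * N k - S k = (m - c) * far2 q p ^+ k.
  elim: k => [|k IHk]; first by rewrite N0 S0; ring.
  by rewrite exprS mulrCA -IHk NS SS far2E; ring.
by rewrite qnorm_inner -/(f n) -/(N n) -plus -minus; ring.
Qed.

Lemma qnorm_conj q : qnorm (qconj q) = qnorm q.
Proof. by rewrite /qnorm /= !sqrrN. Qed.

Lemma near2_conj p q : near2 q (qconj p) = near2 q p.
Proof. by rewrite /near2 /qnorm /= !sqrrN. Qed.

Lemma far2_conj p q : far2 q (qconj p) = far2 q p.
Proof. by rewrite /far2 /qnorm /= !sqrrN. Qed.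

Lemma near2_ge0 p q : 0 <= near2 q p.
Proof. by rewrite addr_ge0 ?sqr_ge0. Qed.

Lemma near2_le_far2 p q : near2 q p <= far2 q p.
Proof.
rewrite -subr_ge0.
have -> : far2 q p - near2 q p = 4 * (qnorm (qim q) * qnorm (qim p)).
  by rewrite /far2 /near2; ring.
by rewrite !mulr_ge0 ?qnorm_ge0.
Qed.

(** On a complex line through [q] the quadratic factors over the two points of that line with the
    real part and the imaginary modulus of [p]; their squared distances to [q] are [near2] and
    [far2]. *)
Lemma qnorm_symmetrization p q :
  qnorm ((q - qreal (qre p)) ^+ 2 + qreal (qnorm (qim p) ^+ 2)) ^+ 2 =
  near2 q p * far2 q p.
Proof.
have nfE : near2 q p * far2 q p =
  ((qre q - qre p) ^+ 2 + qnorm (qim q) ^+ 2 + qnorm (qim p) ^+ 2) ^+ 2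
  - 4 * qnorm (qim q) ^+ 2 * qnorm (qim p) ^+ 2.
  by rewrite /near2 /far2; ring.
rewrite nfE !qnorm_inner expr2 /qinner !quatE /qre /=; ring.
Qed.

(** * Weighted means of powers and comparison with powers *)

Lemma mean_pow_bounds (a b s r u : R) n : 0 <= a -> 0 < b -> 0 <= s <= r ->
  0 <= u -> (a + b) * u ^+ 2 = a * s ^+ n + b * r ^+ n ->
  Num.sqrt (b / (a + b)) * Num.sqrt r ^+ n <= u <= Num.sqrt r ^+ n.
Proof.
move=> a0 b0 /andP[s0 sr] u0 uE.
have ab0 : 0 < a + b by rewrite ltr_wpDl.
have r0 := le_trans s0 sr.
have rE : (Num.sqrt r ^+ n) ^+ 2 = r ^+ n by rewrite -exprM mulnC exprM sqr_sqrtr.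
have bE : Num.sqrt (b / (a + b)) ^+ 2 = b / (a + b).
  by rewrite sqr_sqrtr // divr_ge0 // ltW.
apply/andP; split.
  (* Lower bound: [u ^+ 2] is a weighted mean of [s ^+ n] and [r ^+ n], and the first term is
     dropped. *)
  rewrite -ler_sqr ?nnegrE ?mulr_ge0 ?exprn_ge0 ?sqrtr_ge0 //.
  rewrite exprMn rE bE -(ler_pM2l ab0) uE mulrA mulrCA divff ?gt_eqF // mulr1.
  by rewrite lerDr mulr_ge0 // exprn_ge0.
(* Upper bound: [s ^+ n] is replaced by [r ^+ n]. *)
rewrite -ler_sqr ?nnegrE ?exprn_ge0 ?sqrtr_ge0 // rE -(ler_pM2l ab0) uE mulrDl.
by rewrite lerD2r ler_wpM2l // lerXn2r.
Qed.

(** The constant 1 on the right yields the inequalities of the theorem; a constant on the left that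
    is independent of [n] yields the limits. *)
Definition comparable_to_powers (r : R) (u : nat -> R) :=
  exists2 c : R, 0 < c & forall n, c * r ^+ n <= u n <= r ^+ n.

Lemma exact_powers (r : R) (u : nat -> R) :
  u =1 (fun n => r ^+ n) -> comparable_to_powers r u.
Proof. by move=> uE; exists 1 => // n; rewrite uE mul1r lexx. Qed.

Lemma star_pow_comparable p q :
  comparable_to_powers (sigma q p) (fun n => qnorm (star_pow p n q)).
Proof.
rewrite /sigma; case: asboolP => [/same_line_comm qp|/not_same_line_inner].
  by apply: exact_powers => n; rewrite star_pow_comm // qnormX.
rewrite ltr_norml -/(far2 q p).
set m := _ * _; set c := qinner _ _ => /andP[mc cm].
(* The root of the relative weight of the dominant term [far2 q p ^+ n]. *)
exists (Num.sqrt ((m - c) / (m + c + (m - c)))) => [|n].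
  by rewrite sqrtr_gt0 divr_gt0 ?subr_gt0 //; lra.
apply: (mean_pow_bounds (m + c) (m - c) (near2 q p)); rewrite ?qnorm_ge0 //.
- by lra.
- by lra.
- by rewrite near2_ge0 near2_le_far2.
- by rewrite -star_pow_norm2 -/m; ring.
Qed.

(** * Negative star powers *)

Lemma symmetrization_comm p q : GRing.comm q p ->
  (q - qreal (qre p)) ^+ 2 + qreal (qnorm (qim p) ^+ 2) = (q - p) * (q - qconj p).
Proof.
(* For arbitrary [p] and [q] the two sides differ exactly by the commutator. *)
move=> qp; transitivity ((q - p) * (q - qconj p) - (q * p - p * q)); last first.
  by rewrite [q * p]qp subrr subr0.
by rewrite qnorm_inner expr2 /qinner !quatE /qre /=; congr Quat; ring.
Qed.

Lemma star_npow_comm p q m : GRing.comm q p -> q != p ->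
  star_npow p m q = (q - p) ^- m.
Proof.
move=> qp qNp; rewrite /star_npow; case: eqVneq => [-> //|qNp'].
rewrite star_pow_comm; last exact: comm_qconj.
have unit_qp : (q - p) ^+ m \is a GRing.unit by rewrite unitrX // quat_unitE subr_eq0.
have unit_qp' : (q - qconj p) ^+ m \is a GRing.unit.
  by rewrite unitrX // quat_unitE subr_eq0.
have qp' := comm_qconj _ _ qp.
have cpp' : GRing.comm p (qconj p) by apply: comm_qconj; exact: commr_refl.
have factor_comm : GRing.comm (q - p) (q - qconj p).
  apply: commr_sym; apply: commrB; apply: commr_sym; apply: commrB => //.
(* The two powers are swapped because inversion reverses products: the inverse of the conjugate
   factor then meets the factor it cancels. *)
rewrite symmetrization_comm // exprMn_comm // commrX; last exact/commr_sym/commrX.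
by rewrite invrM // mulrVK.
Qed.

Lemma star_npow_comparable p q : 0 < tau q p ->
  comparable_to_powers (tau q p)^-1 (fun m => qnorm (star_npow p m q)).
Proof.
rewrite /tau; case: asboolP => [/same_line_comm qp|nsl].
  move=> t0; apply: exact_powers => n; rewrite star_npow_comm //; last first.
    by apply: contraTneq t0 => ->; rewrite subrr qnorm0 ltxx.
  by rewrite qnormV qnormX exprVn.
rewrite -/(near2 q p) sqrtr_gt0 => t0.
have s0 := lt_le_trans t0 (near2_le_far2 p q).
have := not_same_line_inner _ _ nsl; rewrite ltr_norml.
set m := _ * _; set c := qinner _ _ => /andP[mc cm].
(* Conjugating [p] turns [c] into [- c], and dividing by [(near2 q p * far2 q p) ^+ n] makes the
   inverse power of [near2 q p] dominant, with weight [m + c]. *)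
exists (Num.sqrt ((m + c) / (m - c + (m + c)))) => [|n].
  by rewrite sqrtr_gt0 divr_gt0 //; lra.
rewrite -sqrtrV; last exact: ltW.
apply: (mean_pow_bounds (m - c) (m + c) (far2 q p)^-1); rewrite ?qnorm_ge0 //.
- by lra.
- by lra.
- by rewrite invr_ge0 ltW //= lef_pV2 ?posrE ?near2_le_far2.
(* Off a common line the exceptional value at the conjugate of [p] does not occur. *)
have qNp : q != qconj p by apply: contra_notN nsl => /eqP ->; exact: same_line_qconj.
rewrite /star_npow (negPf qNp) qnormM qnormV qnormX exprMn exprVn -exprM mulnC.
rewrite exprM qnorm_symmetrization.
have cE : qinner (qim q) (qim (qconj p)) = - c by rewrite /c /qinner /=; ring.
have := star_pow_norm2 (qconj p) q n.
rewrite cE near2_conj far2_conj -[qim (qconj p)]/(qconj (qim p)) qnorm_conj -/m.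
move=> normE; rewrite exprMn !exprVn.
set N := qnorm (star_pow _ _ _) ^+ 2 in normE *.
have tn0 : near2 q p ^+ n != 0 by rewrite expf_neq0 // gt_eqF.
have sn0 : far2 q p ^+ n != 0 by rewrite expf_neq0 // gt_eqF.
transitivity ((2 * m * N) / (near2 q p ^+ n * far2 q p ^+ n)).
  by rewrite mulrA mulrC mulrA; congr (_ / _); ring.
rewrite normE; move: (near2 _ _ ^+ _) (far2 _ _ ^+ _) tn0 sn0 => s t s0' t0'.
by field; rewrite s0'.
Qed.

(** * Limits of roots *)

Lemma comparable_root_cvg (r : R) (u : nat -> R) : 0 <= r ->
  comparable_to_powers r u -> u n `^ (n%:R)^-1 @[n --> \oo] --> r.
Proof.
move=> r0 [c c0 cu].
have rootK n : (r ^+ n.+1) `^ (n.+1%:R)^-1 = r.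
  by rewrite -powR_mulrn // -powRrM divff ?pnatr_eq0 // powRr1.
(* The shift discards the index 0, where the exponent is the default value [0^-1 = 0] and [rootK]
   has no analogue. *)
rewrite -cvg_shiftS.
have cr : c `^ (n.+1%:R)^-1 * r @[n --> \oo] --> r.
  rewrite -[X in _ --> X]mul1r; apply: cvgMl.
  (* The roots of the constant tend to [expR 0 = 1], since [harmonic n] is the inverse of
     [n + 1]. *)
  have -> : (fun n : nat => c `^ (n.+1%:R)^-1) = (fun n => expR (harmonic n * ln c)).
    by apply/funext => n; rewrite /powR gt_eqF.
  rewrite -expR0 -(mul0r (ln c)); apply: continuous_cvg; first exact: continuous_expR.
  by apply: cvgMl; exact: cvg_harmonic.
apply: (squeeze_cvgr _ cr); last exact: cvg_cst.
near=> n; have /andP[lo hi] := cu n.+1.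
have lo0 : 0 <= c * r ^+ n.+1 by rewrite mulr_ge0 ?exprn_ge0 // ltW.
apply/andP; split.
  rewrite -{1}(rootK n) -powRM ?exprn_ge0 ?(ltW c0) //.
  by apply: ge0_ler_powR; rewrite ?nnegrE ?invr_ge0 ?ler0n // (le_trans lo0 lo).
rewrite -[leRHS](rootK n).
by apply: ge0_ler_powR; rewrite ?nnegrE ?invr_ge0 ?ler0n ?exprn_ge0 // (le_trans lo0 lo).
Unshelve. all: by end_near. Qed.

End StarPowers.

Theorem theorem5p8 (R : realType) (p : quat R) :
  [/\ forall (n : nat) (q : quat R), qnorm (star_pow p n q) <= sigma q p ^+ n,
      forall (m : nat) (q : quat R), 0 < tau q p ->
        qnorm (star_npow p m q) <= tau q p ^- m,
      forall q : quat R,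
        qnorm (star_pow p n q) `^ (n%:R)^-1 @[n --> \oo] --> sigma q p &
      forall q : quat R, 0 < tau q p ->
        qnorm (star_npow p m q) `^ (m%:R)^-1 @[m --> \oo] --> (tau q p)^-1].
Proof.
split=> [n q|m q t0|q|q t0].
- by have [c _ /(_ n)/andP[]] := star_pow_comparable R p q.
- by have [c _ /(_ m)/andP[]] := star_npow_comparable R p q t0; rewrite exprVn.
- apply: comparable_root_cvg; last exact: star_pow_comparable.
  by rewrite /sigma; case: ifP => _; exact: sqrtr_ge0.
- apply: comparable_root_cvg; last exact: star_npow_comparable.
  by rewrite invr_ge0 ltW.
Qed.
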